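(* (Generalized Picone identity.) Let $h_1,\dots,h_{kn}$ be linearly independent solutions on $[a,b]$ of the Jacobi equation of $\mathcal{Q}$ with $h_i^{(j)}(a)=0$ for $1\le i\le kn$ and $0\le j\le k-1$. For each $i$ let $(\mu_i(t),\zeta_i(t))\in\mathbb{R}^{kn}\times\mathbb{R}^{kn}$ be the Legendre transform of the $(2k-1)$-jet of $h_i$ at $t$, and let $Y(t)=(\mu_1(t)|\cdots|\mu_{kn}(t))$ and $Z(t)=(\zeta_1(t)|\cdots|\zeta_{kn}(t))$ be the $kn\times kn$ matrices with these columns (so that $Y^{\top}Z-Z^{\top}Y=0$). Suppose that $Y(t)$ is invertible for all $t\in(a,b]$. Let $(y,z)$ be a pair of $\mathbb{R}^{kn}$-valued functions, $y$ differentiable, satisfying $\dot y=A(t)y+B(t)z$. Then on $(a,b]$ $$\frac{d}{dt}\big(y^{\top}ZY^{-1}y\big)=z^{\top}Bz+y^{\top}Cy-(z-ZY^{-1}y)^{\top}B\,(z-ZY^{-1}y).$$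
   Context: Let $a<b$ be real and $k,n\ge1$. Let $M_{ii}$ ($0\le i\le k$) and $M_{i(i+1)}$ ($0\le i\le k-1$) be smooth functions $[a,b]\to\mathbb{R}^{n\times n}$ with every $M_{ii}(t)$ symmetric and $M_{kk}(t)$ positive definite for all $t$ (strong Legendre condition). Put $$L(t,q_0,\dots,q_k)=\tfrac12\sum_{i=0}^kq_i^{\top}M_{ii}(t)q_i+\sum_{i=0}^{k-1}q_i^{\top}M_{i(i+1)}(t)q_{i+1},\qquad \mathcal{Q}[h]=\int_a^bL(t,h,\dot h,\dots,h^{(k)})\,dt .$$ The Jacobi (Euler-Lagrange) equation of $\mathcal{Q}$ is $\sum_{j=0}^k(-1)^j\frac{d^j}{dt^j}\Big(\frac{\partial L}{\partial q_j}(t,h,\dots,h^{(k)})\Big)=0$, a linear ODE of order $2k$ for $h:[a,b]\to\mathbb{R}^n$. The Legendre transform of the $(2k-1)$-jet of a curve $h$ is the pair $(y,z)$, where $y=(h,\dot h,\dots,h^{(k-1)})\in\mathbb{R}^{kn}$ and $z=(z_1,\dots,z_k)\in\mathbb{R}^{kn}$ (column vectors) with $$z_i=\sum_{j=i}^k(-1)^{j-i}\Big(\frac{d}{dt}\Big)^{j-i}\Big(\frac{\partial L}{\partial q_j}(t,h,\dots,h^{(k)})\Big),\qquad i=1,\dots,k.$$ It takes solutions of the Jacobi equation to solutions of the Hamiltonian system $\dot y=Ay+Bz$, $\dot z=Cy-A^{\top}z$, where $A(t),B(t),C(t)$ are the following $kn\times kn$ matrices, written as $k\times k$ arrays of $n\times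 n$ blocks (block rows and columns indexed $1,\dots,k$): - $A$ has the identity in the blocks $(i,i+1)$, $1\le i\le k-1$, the block $-M_{kk}^{-1}M_{(k-1)k}^{\top}$ in position $(k,k)$, and zeros elsewhere. - $B$ has $M_{kk}^{-1}$ in position $(k,k)$ and zeros elsewhere. - $C$ is symmetric block tridiagonal: its $(i,i)$ block is $M_{(i-1)(i-1)}$ for $1\le i\le k-1$, its $(k,k)$ block is $M_{(k-1)(k-1)}-M_{(k-1)k}M_{kk}^{-1}M_{(k-1)k}^{\top}$, its $(i,i+1)$ block is $M_{(i-1)i}$ and its $(i+1,i)$ block is $M_{(i-1)i}^{\top}$ for $1\le i\le k-1$, and all other blocks are zero. *)

(* Defs.v *)
From HB Require Import structures.
From mathcomp Require Import all_boot all_order all_algebra.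
From mathcomp Require Import all_classical all_reals all_analysis.

Set Implicit Arguments.
Unset Strict Implicit.
Unset Printing Implicit Defensive.

Import Order.TTheory GRing.Theory Num.Theory.
Import numFieldNormedType.Exports.

Local Open Scope classical_set_scope.
Local Open Scope ring_scope.

(* Derivatives of curves defined on a set D of reals: the difference quotient
   is taken along D only, so it is one-sided at an endpoint of an interval and
   the values of f outside D are irrelevant. *)

Definition diffquo (R : realType) (V : normedModType R) (f : R -> V) (t s : R)
    : V :=
  (s - t)^-1 *: (f s - f t).

Definition is_deriv_on (R : realType) (V : normedModType R) (D : set R)
    (f : R -> V) (t : R) (l : V) : Prop :=
  diffquo f t s @[s --> within D t^'] --> l.

Definition derivable_on (R : realType) (V : normedModType R) (D : set R)
    (f : R -> V) (t : R) : Prop :=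
  cvg (diffquo f t s @[s --> within D t^']).

Definition deriv_on (R : realType) (V : normedModType R) (D : set R)
    (f : R -> V) (t : R) : V :=
  lim (diffquo f t s @[s --> within D t^']).

Definition derivn_on (R : realType) (V : normedModType R) (D : set R) (j : nat)
    (f : R -> V) : R -> V :=
  iter j (deriv_on D) f.

Definition ntimes_derivable_on (R : realType) (V : normedModType R) (D : set R)
    (N : nat) (f : R -> V) : Prop :=
  forall j t, (j < N)%N -> D t -> derivable_on D (derivn_on D j f) t.

Definition smooth_on (R : realType) (V : normedModType R) (D : set R)
    (f : R -> V) : Prop :=
  forall N, ntimes_derivable_on D N f.

Definition sym_mx (R : realType) (n : nat) (S : 'M[R]_n) : Prop := S^T = S.

Definition posdef_mx (R : realType) (n : nat) (S : 'M[R]_n) : Prop :=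
  forall v : 'cV[R]_n, v != 0 -> 0 < (v^T *m S *m v) 0 0.

(* The coefficients are given as M : nat -> nat -> R -> 'M_n, of which only
   M i i (i <= k) and M i i.+1 (i < k) are ever used. *)

Definition lagrangian (R : realType) (n k : nat) (M : nat -> nat -> R -> 'M[R]_n)
    (t : R) (q : nat -> 'cV[R]_n) : R :=
  2^-1 * (\sum_(0 <= i < k.+1) ((q i)^T *m M i i t *m q i) 0 0)
  + \sum_(0 <= i < k) ((q i)^T *m M i i.+1 t *m q i.+1) 0 0.

(* Column vector of the partial derivatives of L with respect to the
   coordinates of q_j. *)
Definition dLdq (R : realType) (n k : nat) (M : nat -> nat -> R -> 'M[R]_n)
    (j : nat) (t : R) (q : nat -> 'cV[R]_n) : 'cV[R]_n :=
  \col_l derive1 (fun s : R => lagrangian k M t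
            (fun i => if i == j then q i + s *: delta_mx l 0 else q i)) 0.

Definition jet (R : realType) (n : nat) (a b : R) (h : R -> 'cV[R]_n)
    (t : R) : nat -> 'cV[R]_n :=
  fun i => derivn_on `[a, b] i h t.

Definition dLdq_along (R : realType) (n k : nat)
    (M : nat -> nat -> R -> 'M[R]_n) (a b : R) (h : R -> 'cV[R]_n)
    (j : nat) (t : R) : 'cV[R]_n :=
  dLdq k M j t (jet a b h t).

Definition jacobi_solution (R : realType) (n k : nat)
    (M : nat -> nat -> R -> 'M[R]_n) (a b : R) (h : R -> 'cV[R]_n) : Prop :=
  ntimes_derivable_on `[a, b] (2 * k) h /\
  forall t, t \in `[a, b] ->
    \sum_(0 <= j < k.+1)
      (-1) ^+ j *: derivn_on `[a, b] j (dLdq_along k M a b h j) t = 0.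

(* Vectors of R^(kn) and kn x kn matrices are given by k, resp. k x k, blocks
   of size n; block indices start at 0, so k.-1 is the last one. *)
Definition kn (k n : nat) : nat := (\sum_(i < k) n)%N.

Definition legendre_y (R : realType) (n k : nat) (a b : R)
    (h : R -> 'cV[R]_n) (t : R) : 'cV[R]_(kn k n) :=
  \mxcol_(i < k) derivn_on `[a, b] i h t.

(* Block i is z_(i+1): the momenta are traditionally numbered z_1, ..., z_k. *)
Definition legendre_z (R : realType) (n k : nat)
    (M : nat -> nat -> R -> 'M[R]_n) (a b : R)
    (h : R -> 'cV[R]_n) (t : R) : 'cV[R]_(kn k n) :=
  \mxcol_(i < k) \sum_(i.+1 <= j < k.+1)
    (-1) ^+ (j - i.+1) *: derivn_on `[a, b] (j - i.+1) (dLdq_along k M a b h j) t.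

Definition HamA (R : realType) (n k : nat) (M : nat -> nat -> R -> 'M[R]_n)
    (t : R) : 'M[R]_(kn k n) :=
  \mxblock_(i < k, j < k)
    (if (j == i.+1 :> nat) then 1%:M
     else if (i.+1 == k) && (j.+1 == k)
     then - (invmx (M k k t) *m (M k.-1 k t)^T)
     else 0).

Definition HamB (R : realType) (n k : nat) (M : nat -> nat -> R -> 'M[R]_n)
    (t : R) : 'M[R]_(kn k n) :=
  \mxblock_(i < k, j < k)
    (if (i.+1 == k) && (j.+1 == k) then invmx (M k k t) else 0).

Definition HamC (R : realType) (n k : nat) (M : nat -> nat -> R -> 'M[R]_n)
    (t : R) : 'M[R]_(kn k n) :=
  \mxblock_(i < k, j < k)
    (if (i == j :> nat) then
       if i.+1 == k then
         M k.-1 k.-1 t - M k.-1 k t *m invmx (M k k t) *m (M k.-1 k t)^T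
       else M i i t
     else if (j == i.+1 :> nat) then M i j t
     else if (i == j.+1 :> nat) then (M j i t)^T
     else 0).

Definition lin_indep_on (R : realType) (n N : nat) (D : set R)
    (h : 'I_N -> R -> 'cV[R]_n) : Prop :=
  forall c : 'I_N -> R,
    (forall t, D t -> \sum_i c i *: h i t = 0) -> forall i, c i = 0.

Definition cols_mx (R : realType) (m N : nat) (v : 'I_N -> 'cV[R]_m)
    : 'M[R]_(m, N) :=
  \matrix_(i, j) v j i 0.

(* Main.v *)
Require Import Defs.
From HB Require Import structures.
From mathcomp Require Import all_boot all_order all_algebra.
From mathcomp Require Import all_classical all_reals all_analysis.
From mathcomp Require Import ring.

(** Put W = Z Y^-1. Along the Hamiltonian system Y' = AY + BZ, Z' = CY - A^T Z,
    with B and C symmetric, W is a symmetric solution of the Riccati equation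
    W' = C - A^T W - W A - W B W. Differentiating y^T W y with y' = Ay + Bz, the
    terms containing A cancel, and what is left,
    y^T C y + z^T B W y + y^T W B z - y^T W B W y, is the right-hand side after
    completing the square ([picone_riccati]).

    Three facts make this applicable. First, the Legendre transform turns a
    Jacobi solution into a solution of the Hamiltonian system
    ([legendre_y_is_deriv], [legendre_z_is_deriv]): the momenta satisfy
    z_i' = dL/dq_(i-1) - z_(i-1), where the Jacobi equation says z_0 = 0, and
    h^(k) is recovered from z_k = dL/dq_k because M_kk is invertible. The only
    delicate point is regularity: dL/dq_j involves h up to order j + 1 at most
    (k when j = k), so that 2k derivatives of h suffice to differentiate dL/dq_j
    j times. Second, W is symmetric because Y^T Z - Z^T Y has zero derivative,
    hence is constant on [a, b], and Y(a) = 0 ([hamiltonian_symplectic]).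
    Third, t |-> Y(t)^-1 is differentiable where Y is invertible, which rests on
    the continuity of the determinant ([is_deriv_on_invmx]). *)

Set Implicit Arguments.
Unset Strict Implicit.
Unset Printing Implicit Defensive.

Import Order.TTheory GRing.Theory Num.Theory.
Import numFieldNormedType.Exports.

Local Open Scope classical_set_scope.
Local Open Scope ring_scope.

(** * Limits of matrix-valued functions *)

Lemma cvg_mxP (R : realType) (T : Type) (F : set_system T) (m p : nat)
    (f : T -> 'M[R]_(m, p)) (l : 'M[R]_(m, p)) : Filter F ->
  f @ F --> l <-> forall i j, f x i j @[x --> F] --> l i j.
Proof.
move=> FF; split=> [fl i j|fl].
  apply: (cvg_comp f (fun A : 'M[R]_(m, p) => A i j) fl).
  exact: coord_continuous.
apply/cvg_ballP => e e0.
have : \forall x \near F, forall ij : 'I_m * 'I_p,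
    ball (l ij.1 ij.2) e (f x ij.1 ij.2).
  by apply: filter_forall => -[i j]; move/cvg_ballP : (fl i j); exact.
by apply: filterS => x fx; split=> // i j; exact: (fx (i, j)).
Qed.

Lemma cvg_mulmx (R : realType) (T : Type) (F : set_system T) (m p q : nat)
    (f : T -> 'M[R]_(m, p)) (g : T -> 'M[R]_(p, q))
    (lf : 'M[R]_(m, p)) (lg : 'M[R]_(p, q)) : Filter F ->
  f @ F --> lf -> g @ F --> lg -> f x *m g x @[x --> F] --> lf *m lg.
Proof.
move=> FF /cvg_mxP fl /cvg_mxP gl; apply/cvg_mxP => i j.
rewrite mxE; under eq_cvg do rewrite mxE.
by apply: (cvg_big add_continuous) => l _; exact: cvgM.
Qed.

Lemma cvg_det (R : realType) (T : Type) (F : set_system T) (m : nat)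
    (f : T -> 'M[R]_m) (l : 'M[R]_m) : Filter F ->
  f @ F --> l -> \det (f x) @[x --> F] --> \det l.
Proof.
move=> FF /cvg_mxP fl; apply: (cvg_big add_continuous) => s _.
by apply: cvgM; [exact: cvg_cst|apply: (cvg_big mul_continuous) => i _].
Qed.

(** Cramer's rule: near the limit the inverse is the adjugate over the
    determinant, both polynomial in the entries. *)
Lemma cvg_invmx (R : realType) (T : Type) (F : set_system T) (m : nat)
    (f : T -> 'M[R]_m) (l : 'M[R]_m) : Filter F -> l \in unitmx ->
  (\forall x \near F, f x \in unitmx) ->
  f @ F --> l -> invmx (f x) @[x --> F] --> invmx l.
Proof.
move=> FF lu fu fl.
have : (\det (f x))^-1 *: \adj (f x) @[x --> F] --> invmx l.
  rewrite /invmx lu; apply/cvg_mxP => i j.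
  rewrite !mxE; under eq_cvg do rewrite !mxE.
  apply: cvgM; first by apply: cvgV; [rewrite -unitfE|exact: cvg_det].
  apply: cvgM; first exact: cvg_cst.
  apply: cvg_det; apply/cvg_mxP => r c; rewrite !mxE.
  by under eq_cvg do rewrite !mxE; move/cvg_mxP : fl; exact.
apply: cvg_trans; apply: near_eq_cvg.
by apply: filterS fu => x fx; rewrite /invmx fx.
Qed.

(** * Derivatives along a set *)

Section is_deriv_on_theory.
Variables (R : realType) (D : set R) (t : R).

Let near_neq : \forall s \near within D t^', s != t.
Proof. exact: (cvg_within _ (nbhs_dnbhs_neq t)). Qed.

Lemma is_deriv_on_ext (V : normedModType R) (f g : R -> V) l : D t ->
  (forall s, D s -> f s = g s) -> is_deriv_on D f t l -> is_deriv_on D g t l.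
Proof.
move=> Dt fg; apply: cvg_trans; apply: near_eq_cvg.
by apply: filterS (withinT D _) => s Ds; rewrite /diffquo !fg.
Qed.

Lemma is_deriv_on_subset (V : normedModType R) (E : set R) (f : R -> V) l :
  D `<=` E -> is_deriv_on E f t l -> is_deriv_on D f t l.
Proof. by move=> DE; apply: cvg_trans; apply: cvg_fmap2; exact: within_subset. Qed.

Lemma is_deriv_on_cst (V : normedModType R) (c : V) :
  is_deriv_on D (fun=> c) t 0.
Proof.
rewrite /is_deriv_on /diffquo.
by under eq_cvg do rewrite subrr scaler0; exact: cvg_cst.
Qed.

Lemma is_deriv_onD (V : normedModType R) (f g : R -> V) lf lg :
  is_deriv_on D f t lf -> is_deriv_on D g t lg ->
  is_deriv_on D (fun s => f s + g s) t (lf + lg).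
Proof.
move=> fl gl; rewrite /is_deriv_on /diffquo.
by under eq_cvg do rewrite opprD addrACA scalerDr; exact: cvgD.
Qed.

Lemma is_deriv_onZ (V : normedModType R) (c : R) (f : R -> V) l :
  is_deriv_on D f t l -> is_deriv_on D (fun s => c *: f s) t (c *: l).
Proof.
move=> fl; rewrite /is_deriv_on /diffquo.
under eq_cvg do rewrite -scalerBr scalerA mulrC -scalerA.
by apply: cvgZ => //; exact: cvg_cst.
Qed.

Lemma is_deriv_onB (V : normedModType R) (f g : R -> V) lf lg :
  is_deriv_on D f t lf -> is_deriv_on D g t lg ->
  is_deriv_on D (fun s => f s - g s) t (lf - lg).
Proof.
move=> fl gl; have := is_deriv_onD fl (@is_deriv_onZ _ (-1) _ _ gl).
by rewrite scaleN1r; under eq_fun do rewrite scaleN1r.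
Qed.

Lemma is_deriv_on_sum (V : normedModType R) (I : Type) (r : seq I) (P : pred I)
    (f : I -> R -> V) (l : I -> V) :
  (forall i, P i -> is_deriv_on D (f i) t (l i)) ->
  is_deriv_on D (fun s => \sum_(i <- r | P i) f i s) t (\sum_(i <- r | P i) l i).
Proof.
move=> fl; rewrite /is_deriv_on /diffquo.
under eq_cvg do rewrite -sumrB scaler_sumr.
exact: (cvg_big add_continuous).
Qed.

Lemma is_deriv_on_continuous (V : normedModType R) (f : R -> V) l :
  is_deriv_on D f t l -> f s @[s --> within D t^'] --> f t.
Proof.
move=> fl.
have st : (s - t) @[s --> within D t^'] --> (0 : R).
  rewrite -(subrr t); apply: cvgB; last exact: cvg_cst.
  by apply: (@cvg_within_filter _ _ id t^'); exact: nbhs_dnbhs.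
have : (s - t) *: diffquo f t s + f t @[s --> within D t^'] --> f t.
  rewrite -[X in _ --> X]add0r -(scale0r l).
  by apply: cvgD; [exact: cvgZ|exact: cvg_cst].
apply: cvg_trans; apply: near_eq_cvg.
near=> s; rewrite /= /diffquo scalerA divff ?scale1r ?subrK //.
by rewrite subr_eq0; near: s.
Unshelve. all: by end_near. Qed.

Lemma is_deriv_on_mxP (m p : nat) (f : R -> 'M[R]_(m, p)) l :
  is_deriv_on D f t l <->
  forall i j, is_deriv_on D (fun s => f s i j : R) t (l i j).
Proof.
rewrite /is_deriv_on cvg_mxP; split=> fl i j.
  by have := fl i j; under eq_cvg do rewrite !mxE.
by under eq_cvg do rewrite !mxE; exact: fl.
Qed.

Lemma is_deriv_on_trmx (m p : nat) (f : R -> 'M[R]_(m, p)) l :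
  is_deriv_on D f t l -> is_deriv_on D (fun s => (f s)^T) t l^T.
Proof.
move=> /is_deriv_on_mxP fl; apply/is_deriv_on_mxP => i j.
by rewrite mxE; under eq_fun do rewrite mxE; exact: fl.
Qed.

(** The increment splits as (f s - f t) g s + f t (g s - g t), keeping the order of
    the factors. *)
Lemma is_deriv_on_mulmx (m p q : nat) (f : R -> 'M[R]_(m, p))
    (g : R -> 'M[R]_(p, q)) lf lg :
  is_deriv_on D f t lf -> is_deriv_on D g t lg ->
  is_deriv_on D (fun s => f s *m g s) t (lf *m g t + f t *m lg).
Proof.
move=> fl gl.
have : diffquo f t s *m g s + f t *m diffquo g t s @[s --> within D t^']
    --> lf *m g t + f t *m lg.
  apply: cvgD; last by apply: cvg_mulmx => //; exact: cvg_cst.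
  by apply: cvg_mulmx => //; exact: is_deriv_on_continuous gl.
apply: cvg_trans; apply: near_eq_cvg; apply: nearW => s.
rewrite /diffquo -scalemxAl -scalemxAr -scalerDr; congr (_ *: _).
by rewrite mulmxBl mulmxBr addrA subrK.
Qed.

(** From f(s)^-1 - f(t)^-1 = - f(s)^-1 (f s - f t) f(t)^-1 and the continuity of
    the inverse. *)
Lemma is_deriv_on_invmx (m : nat) (f : R -> 'M[R]_m) l :
  D t -> (forall s, D s -> f s \in unitmx) -> is_deriv_on D f t l ->
  is_deriv_on D (fun s => invmx (f s)) t (- (invmx (f t) *m l *m invmx (f t))).
Proof.
move=> Dt fu fl; rewrite /is_deriv_on.
have nu : \forall s \near within D t^', f s \in unitmx.
  by apply: filterS (withinT D _) => s Ds; exact: fu.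
have : - (invmx (f s) *m diffquo f t s *m invmx (f t)) @[s --> within D t^']
    --> - (invmx (f t) *m l *m invmx (f t)).
  apply: cvgN; apply: cvg_mulmx; last exact: cvg_cst.
  apply: cvg_mulmx => //; apply: cvg_invmx => //; first exact: fu.
  exact: is_deriv_on_continuous fl.
apply: cvg_trans; apply: near_eq_cvg; apply: filterS nu => s us.
rewrite /diffquo -scalemxAr -scalemxAl -scalerN mulmxBr mulmxBl mulVmx // mul1mx.
by rewrite -mulmxA mulmxV ?mulmx1 ?opprB //; exact: fu.
Qed.

End is_deriv_on_theory.

(** Links the derivative along a set to the usual one at interior points, which
    is what the mean value theorem asks for. *)
Lemma is_deriv_on_nbhs (R : realType) (D : set R) (f : R -> R) (t l : R) :
  nbhs t D -> is_deriv_on D f t l -> is_derive t 1 f l.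
Proof.
move=> tD fl; apply/is_derive1_caratheodory.
exists (fun s => if s == t then l else diffquo f t s); split.
- move=> s; case: eqVneq => [->|st]; first by rewrite !subrr mulr0.
  by rewrite mulrC /diffquo mulVKf // subr_eq0.
- apply/continuous_withinNx; rewrite eqxx.
  have : diffquo f t s @[s --> t^'] --> l.
    apply: cvg_trans fl; apply: cvg_fmap2 => P DP.
    have tD' : t^' D by exact: nbhs_dnbhs.
    by apply: filterS2 tD' (DP : t^' (fun s => D s -> P s)) => s Ds; exact.
  apply: cvg_trans; apply: near_eq_cvg; near=> s.
  by rewrite ifN //; near: s; exact: nbhs_dnbhs_neq.
- by rewrite eqxx.
Unshelve. all: by end_near. Qed.

(** The filter of [is_deriv_on] omits the point t itself, whereas continuity
    within D includes it. *)
Lemma is_deriv_on_within_continuous (R : realType) (D : set R) (f df : R -> R) :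
  (forall t, D t -> is_deriv_on D f t (df t)) -> {within D, continuous f}.
Proof.
move=> fl; apply/subspace_continuousP => t Dt P Pft.
have Pf : nbhs t (fun s => s != t -> D s -> P (f s)).
  exact: (is_deriv_on_continuous (fl t Dt) Pft).
change (nbhs t (fun s => D s -> P (f s))).
apply: filterS Pf => s Ps Ds.
case: (eqVneq s t) => [->|st]; last exact: Ps.
exact: nbhs_singleton.
Qed.

Lemma is_deriv_on0_cst (R : realType) (a b : R) (f : R -> R) :
  (forall t, `[a, b]%classic t -> is_deriv_on `[a, b] f t 0) ->
  forall t, `[a, b]%classic t -> f t = f a.
Proof.
move=> f0 t tab; have /itvP tabE := tab.
have [at_|ta|<-] := ltgtP a t; last by [].
- have sub : `[a, t] `<=` `[a, b].
    by apply: subset_itvl; rewrite bnd_simp tabE.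
  have [||c _] := @MVT R f (fun=> 0) a t at_.
  + move=> x /[dup] xat /itvP xatE; apply: (@is_deriv_on_nbhs _ `[a, t]).
      apply: filterS (near_in_itvoo xat) => y; exact: subset_itv_oo_cc.
    apply: (is_deriv_on_subset sub); apply: f0; apply: sub.
    exact: subset_itv_oo_cc.
  + apply: (@is_deriv_on_within_continuous _ _ _ (fun=> 0)) => x xat.
    by apply: (is_deriv_on_subset sub); apply: f0; exact: sub.
  + by rewrite mul0r => /eqP; rewrite subr_eq0 => /eqP.
- by move: ta; rewrite ltNge tabE.
Qed.

(** * Repeated derivatives on a segment *)

Section deriv_on_segment.
Variables (R : realType) (a b : R).
Hypothesis ab : a < b.
Let D : set R := `[a, b].

(** A nondegenerate segment accumulates at each of its points, from the right
    except at b, so limits along it, hence [deriv_on], are unique. *)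
Lemma within_segment_proper t : D t -> ProperFilter (within D t^').
Proof.
move=> /itvP tab; apply: Build_ProperFilter => P0.
have {}P0 : \forall s \near t, s != t -> D s -> False by [].
have [tb|] := ltP t b.
  have : \forall s \near t^'+, False.
    near=> s; have : s != t -> D s -> False by near: s; exact: cvg_within.
    apply; first by rewrite gt_eqF //; near: s; exact: nbhs_right_gt.
    rewrite /D /= in_itv /=; apply/andP; split.
      apply: (@le_trans _ _ t); first by rewrite tab.
      by apply: ltW; near: s; exact: nbhs_right_gt.
    by apply: ltW; near: s; exact: nbhs_right_lt.
  by move=> /filter_ex[].
move=> bt; have tb : t = b by apply/eqP; rewrite eq_le bt tab.
move: P0; rewrite {bt}tb => P0.
have : \forall s \near b^'-, False.
  near=> s; have : s != b -> D s -> False by near: s; exact: cvg_within.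
  apply; first by rewrite lt_eqF //; near: s; exact: nbhs_left_lt.
  rewrite /D /= in_itv /=; apply/andP; split.
    by apply: ltW; near: s; exact: nbhs_left_gt.
  by apply: ltW; near: s; exact: nbhs_left_lt.
by move=> /filter_ex[].
Unshelve. all: by end_near. Qed.

Lemma is_deriv_onP (V : normedModType R) (f : R -> V) t l :
  D t -> is_deriv_on D f t l -> derivable_on D f t /\ deriv_on D f t = l.
Proof.
move=> Dt fl; have PF := within_segment_proper Dt; split.
  by apply/cvg_ex; exists l.
by apply: cvg_lim => //; exact: norm_hausdorff.
Qed.

Lemma derivable_on_is_deriv (V : normedModType R) (f : R -> V) t :
  derivable_on D f t -> is_deriv_on D f t (deriv_on D f t).
Proof. by []. Qed.

Lemma ntimes_derivable_onS (V : normedModType R) N (f : R -> V) :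
  ntimes_derivable_on D N.+1 f <->
  (forall t, D t -> derivable_on D f t) /\ ntimes_derivable_on D N (deriv_on D f).
Proof.
split=> [fN|[f1 fN] [|j] t jN Dt]; last 2 first.
- exact: f1.
- by rewrite /derivn_on iterSr; exact: fN.
split=> [t|j t jN] Dt; first by have := fN 0%N t isT Dt.
by have := fN j.+1 t jN Dt; rewrite /derivn_on iterSr.
Qed.

Lemma eq_derivn_on (V : normedModType R) (f g : R -> V) :
  (forall t, D t -> f t = g t) ->
  forall j t, D t -> derivn_on D j f t = derivn_on D j g t.
Proof.
move=> fg; elim=> [|j IH] t Dt; first exact: fg.
rewrite /= /deriv_on; congr lim; rewrite eqEsubset; split.
  apply: near_eq_cvg; apply: filterS (withinT D _) => s Ds.
  by rewrite /diffquo !IH.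
apply: near_eq_cvg; apply: filterS (withinT D _) => s Ds.
by rewrite /diffquo !IH.
Qed.

Lemma eq_ntimes_derivable_on (V : normedModType R) N (f g : R -> V) :
  (forall t, D t -> f t = g t) ->
  ntimes_derivable_on D N f -> ntimes_derivable_on D N g.
Proof.
move=> fg fN j t jN Dt.
have /derivable_on_is_deriv fj := fN j t jN Dt.
apply: (is_deriv_onP Dt _).1; apply: is_deriv_on_ext Dt _ fj.
exact: eq_derivn_on.
Qed.

(** The induction step of all the closure properties below: it suffices to exhibit
    a derivative on D that is itself N times derivable. *)
Lemma ntimes_derivable_onS_is_deriv (V : normedModType R) N (f g : R -> V) :
  (forall t, D t -> is_deriv_on D f t (g t)) ->
  ntimes_derivable_on D N g -> ntimes_derivable_on D N.+1 f.
Proof.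
move=> fg gN; apply/ntimes_derivable_onS; split=> [t Dt|].
  exact: (is_deriv_onP Dt (fg t Dt)).1.
apply: eq_ntimes_derivable_on gN => t Dt.
by have [_ ->] := is_deriv_onP Dt (fg t Dt).
Qed.

Lemma ntimes_derivable_on_le (V : normedModType R) N N' (f : R -> V) :
  (N' <= N)%N -> ntimes_derivable_on D N f -> ntimes_derivable_on D N' f.
Proof. by move=> NN' fN j t jN; apply: fN; exact: leq_trans NN'. Qed.

Lemma ntimes_derivable_on_derivn (V : normedModType R) N i (f : R -> V) :
  ntimes_derivable_on D (N + i) f -> ntimes_derivable_on D N (derivn_on D i f).
Proof.
move=> fN j t jN Dt; rewrite /derivn_on -iterD; apply: fN => //.
by rewrite ltn_add2r.
Qed.

Lemma ntimes_derivable_on0 (V : normedModType R) N :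
  ntimes_derivable_on D N (fun=> 0 : V).
Proof.
elim: N => [//|N IH]; apply: ntimes_derivable_onS_is_deriv IH => t Dt.
exact: is_deriv_on_cst.
Qed.

Lemma ntimes_derivable_onD (V : normedModType R) N (f g : R -> V) :
  ntimes_derivable_on D N f -> ntimes_derivable_on D N g ->
  ntimes_derivable_on D N (fun t => f t + g t).
Proof.
elim: N f g => [//|N IH] f g /ntimes_derivable_onS[f1 fN]
  /ntimes_derivable_onS[g1 gN].
apply: ntimes_derivable_onS_is_deriv (IH _ _ fN gN) => t Dt.
by apply: is_deriv_onD; apply: derivable_on_is_deriv; [exact: f1|exact: g1].
Qed.

Lemma ntimes_derivable_on_trmx m p N (f : R -> 'M[R]_(m, p)) :
  ntimes_derivable_on D N f -> ntimes_derivable_on D N (fun t => (f t)^T).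
Proof.
elim: N f => [//|N IH] f /ntimes_derivable_onS[f1 fN].
apply: ntimes_derivable_onS_is_deriv (IH _ fN) => t Dt.
by apply: is_deriv_on_trmx; apply: derivable_on_is_deriv; exact: f1.
Qed.

Lemma ntimes_derivable_on_mulmx m p q N (f : R -> 'M[R]_(m, p))
    (g : R -> 'M[R]_(p, q)) :
  ntimes_derivable_on D N f -> ntimes_derivable_on D N g ->
  ntimes_derivable_on D N (fun t => f t *m g t).
Proof.
elim: N f g => [//|N IH] f g.
move=> /[dup] /(ntimes_derivable_on_le (leqnSn N)) f0.
move=> /ntimes_derivable_onS[f1 fN].
move=> /[dup] /(ntimes_derivable_on_le (leqnSn N)) g0.
move=> /ntimes_derivable_onS[g1 gN].
apply: ntimes_derivable_onS_is_deriv
  (ntimes_derivable_onD (IH _ _ fN g0) (IH _ _ f0 gN)) => t Dt.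
by apply: is_deriv_on_mulmx; apply: derivable_on_is_deriv; [exact: f1|exact: g1].
Qed.

End deriv_on_segment.

(** * Partial gradients of the Lagrangian *)

(** L is quadratic in its jet arguments, so it is a polynomial of degree 2 in s
    along any line. *)
Lemma lagrangian_line (R : realType) (n k : nat)
    (M : nat -> nat -> R -> 'M[R]_n) (t s : R) (q e : nat -> 'cV[R]_n) :
  lagrangian k M t (fun i => q i + s *: e i) = lagrangian k M t q
  + s * (2^-1 * (\sum_(0 <= i < k.+1) (((q i)^T *m M i i t *m e i) 0 0
                                  + ((e i)^T *m M i i t *m q i) 0 0))
         + \sum_(0 <= i < k) (((q i)^T *m M i i.+1 t *m e i.+1) 0 0
                              + ((e i)^T *m M i i.+1 t *m q i.+1) 0 0))
  + s ^+ 2 * lagrangian k M t e.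
Proof.
have bil (A : 'M[R]_n) (u v x y : 'cV[R]_n) :
    ((u + s *: x)^T *m A *m (v + s *: y)) 0 0 = (u^T *m A *m v) 0 0
     + s * ((u^T *m A *m y) 0 0 + (x^T *m A *m v) 0 0)
     + s ^+ 2 * (x^T *m A *m y) 0 0.
  have -> : (u + s *: x)^T = u^T + s *: x^T by rewrite linearD linearZ.
  rewrite !mulmxDl !mulmxDr -!scalemxAr -!scalemxAl.
  rewrite scalerA -expr2 !mxE; ring.
rewrite /lagrangian; under eq_bigr do rewrite bil.
rewrite [\sum_(0 <= i < k) ((_ + _)^T *m _ *m _) 0 0](eq_bigr _
  (fun i _ => bil _ _ _ _ _)).
rewrite !big_split /= -!mulr_sumr !big_split /=; ring.
Qed.

Definition lagrangian_grad (R : realType) (n k : nat)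
    (M : nat -> nat -> R -> 'M[R]_n) (j : nat) (t : R) (q : nat -> 'cV[R]_n)
    : 'cV[R]_n :=
  M j j t *m q j + (if (j < k)%N then M j j.+1 t *m q j.+1 else 0)
  + (if j is j'.+1 then (M j' j t)^T *m q j' else 0).

Lemma derive1_quadratic (R : realType) (c g h : R) :
  derive1 (fun s => c + s * g + s ^+ 2 * h) 0 = g.
Proof.
rewrite derive1E; apply: derive_val; apply: is_derive_eq.
by rewrite !(scaler0, add0r, addr0, scale0r, mul1r); exact: mulr1.
Qed.

(** The line in direction e_l at position j meets at most three terms of L: the
    diagonal one, doubled by symmetry, which cancels the factor 1/2, and the two
    couplings of q_j with q_(j+1) and q_(j-1). *)
Lemma dLdqE (R : realType) (n k : nat) (M : nat -> nat -> R -> 'M[R]_n)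
    (j : nat) (t : R) (q : nat -> 'cV[R]_n) :
  (j <= k)%N -> sym_mx (M j j t) -> dLdq k M j t q = lagrangian_grad k M j t q.
Proof.
move=> jk Ms; apply/colP => l; rewrite mxE.
pose e i : 'cV[R]_n := if i == j then delta_mx l 0 else 0.
under [X in derive1 X]eq_fun => s.
  rewrite (_ : (fun i => _) = fun i => q i + s *: e i); last first.
    by apply/funext => i; rewrite /e; case: eqP => // _; rewrite scaler0 addr0.
  rewrite lagrangian_line; over.
rewrite derive1_quadratic /lagrangian_grad.
have deltaE (X : 'cV[R]_n) : ((delta_mx l 0)^T *m X) 0 0 = X l 0.
  rewrite !mxE (bigD1 l) //= big1 => [|r rl].
    by rewrite !mxE !eqxx mul1r addr0.
  by rewrite !mxE (negPf rl) mul0r.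
have trE (A : 'M[R]_n) (u v : 'cV[R]_n) :
    (u^T *m A *m v) 0 0 = (v^T *m (A^T *m u)) 0 0.
  by rewrite -[u in RHS]trmxK -!trmx_mul [RHS]mxE.
rewrite (eq_bigr (fun i => if i == j then 2 * (M j j t *m q j) l 0 else 0));
  last first.
  move=> i _; rewrite /e; case: eqP => [->|_].
    by rewrite trE Ms -mulmxA deltaE mulr_natl.
  by rewrite mulmx0 trmx0 !mul0mx !mxE addr0.
rewrite -big_mkcond big_nat1_eq ltnS jk mulrA mulVf ?mul1r ?pnatr_eq0 //.
rewrite big_split /= [X in _ + X]addrC [RHS]mxE [X in _ = X + _]mxE -addrA.
congr (_ + (_ + _)).
  rewrite (eq_bigr (fun i => if i == j then (M j j.+1 t *m q j.+1) l 0 else 0)).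
    by rewrite -big_mkcond big_nat1_eq /=; case: (j < k)%N => //; rewrite mxE.
  move=> i _; rewrite /e; case: eqP => [->|_]; first by rewrite -mulmxA deltaE.
  by rewrite trmx0 !mul0mx mxE.
rewrite /e; case: j jk {Ms e} => [|j] jk.
  by rewrite big1 ?mxE // => i _; rewrite mulmx0 mxE.
rewrite (eq_bigr (fun i => if i == j then ((M j j.+1 t)^T *m q j) l 0 else 0)).
  by rewrite -big_mkcond big_nat1_eq jk.
move=> i _; rewrite eqSS; case: eqP => [->|_]; first by rewrite trE deltaE.
by rewrite mulmx0 mxE.
Qed.

(** * The Hamiltonian matrices acting on block columns *)

Section hamiltonian_blocks.
Variables (R : realType) (n k : nat) (M : nat -> nat -> R -> 'M[R]_n) (t : R).
Implicit Types u : nat -> 'cV[R]_n.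

Let invMkk := invmx (M k k t).

Definition blockcol u : 'cV[R]_(kn k n) := \mxcol_(i < k) u i.

Lemma eq_blockcol u v : (forall i, (i < k)%N -> u i = v i) ->
  blockcol u = blockcol v.
Proof. by move=> uv; apply: eq_mxcol => i; exact: uv. Qed.

Lemma blockcolD u v : blockcol u + blockcol v = blockcol (fun i => u i + v i).
Proof. by rewrite /blockcol mxcolD. Qed.

Lemma blockcolB u v : blockcol u - blockcol v = blockcol (fun i => u i - v i).
Proof. by rewrite /blockcol mxcolB. Qed.

(** Off the last block row A is the shift; in the last one the shift would leave
    the array and the feedback term takes its place. *)
Lemma HamA_blockcol u : HamA k M t *m blockcol u =
  blockcol (fun i => if i.+1 == k then - (invMkk *m (M k.-1 k t)^T *m u i)
                     else u i.+1).
Proof.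
rewrite /HamA /blockcol mul_mxblock_mxrow; apply: eq_mxcol => i.
rewrite -(big_mkord xpredT (fun j => (if j == i.+1 then 1%:M
     else if (i.+1 == k) && (j.+1 == k)
     then - (invmx (M k k t) *m (M k.-1 k t)^T)
     else 0) *m u j)).
case: eqP => [ik|/eqP ik].
  rewrite (eq_big_nat _ _ (F2 := fun j => if j == i :> nat then
     - (invMkk *m (M k.-1 k t)^T *m u i) else 0)).
    by rewrite -big_mkcond big_nat1_eq ltn_ord.
  move=> j /andP[_ jk] /=; rewrite ik (ltn_eqF jk).
  have -> : (j.+1 == k) = (j == i) by rewrite -(eqSS j i) [in RHS]ik.
  by case: eqP => [->|_]; rewrite ?mul0mx ?mulNmx.
rewrite (eq_bigr (fun j => if j == i.+1 then u i.+1 else 0)).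
  by rewrite -big_mkcond big_nat1_eq ltn_neqAle ik /= ltn_ord.
by move=> j _ /=; case: eqP => [->|_]; rewrite ?mul1mx ?mul0mx.
Qed.

Lemma HamB_blockcol u : HamB k M t *m blockcol u =
  blockcol (fun i => if i.+1 == k then invMkk *m u i else 0).
Proof.
rewrite /HamB /blockcol mul_mxblock_mxrow; apply: eq_mxcol => i.
rewrite -(big_mkord xpredT (fun j => (if (i.+1 == k) && (j.+1 == k)
     then invmx (M k k t) else 0) *m u j)).
case: eqP => [ik|_]; last by rewrite big1 // => j _; rewrite mul0mx.
rewrite (eq_bigr (fun j => if j == i :> nat then invMkk *m u i else 0)).
  by rewrite -big_mkcond big_nat1_eq ltn_ord.
move=> j _ /=; have -> : (j.+1 == k) = (j == i) by rewrite -(eqSS j i) [in RHS]ik.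
by case: eqP => [->|_]; rewrite ?mul0mx.
Qed.

(** Transposing turns the shift around: block i receives u_(i-1), and the feedback
    term stays in the corner. *)
Lemma trHamA_blockcol u : (HamA k M t)^T *m blockcol u =
  blockcol (fun i => (if i is i'.+1 then u i' else 0)
    - (if i.+1 == k then M k.-1 k t *m invMkk^T *m u i else 0)).
Proof.
rewrite /HamA /blockcol tr_mxblock mul_mxblock_mxrow; apply: eq_mxcol => i.
rewrite -(big_mkord xpredT (fun j => (if i == j.+1 :> nat then 1%:M
     else if (j.+1 == k) && (i.+1 == k)
     then - (invmx (M k k t) *m (M k.-1 k t)^T)
     else 0)^T *m u j)).
have -> : (if i.+1 == k then M k.-1 k t *m invMkk^T *m u i else 0) =
    \sum_(0 <= j < k | j == i :> nat)
      (if i.+1 == k then M k.-1 k t *m invMkk^T *m u i else 0).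
  by rewrite big_nat1_eq ltn_ord.
have -> : (if nat_of_ord i is i'.+1 then u i' else 0) =
    \sum_(0 <= j < k | i == j.+1 :> nat) u j.
  case: i => -[|i] ik /=; first by rewrite big_pred0.
  by under eq_bigl do rewrite eqSS eq_sym; rewrite big_nat1_eq /= (ltnW ik).
rewrite (big_mkcond (fun j => i == j.+1 :> nat)).
rewrite (big_mkcond (fun j => j == i :> nat)).
rewrite -sumrB; apply: eq_bigr => j _.
case: (eqVneq (nat_of_ord i) j.+1) => [ij|ij].
  by rewrite trmx1 mul1mx ij [j == _]ltn_eqF ?subr0.
rewrite sub0r; case: (eqVneq j (nat_of_ord i)) => [->|ji].
  rewrite andbb; case: ifP; rewrite ?trmx0 ?mul0mx ?oppr0 // => _.
  by rewrite [(- _)^T]linearN /= trmx_mul trmxK mulNmx.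
rewrite oppr0; case: ifP => [/andP[/eqP jk /eqP]|_]; last by rewrite trmx0 mul0mx.
by rewrite -[X in _ = X]jk => -[eij]; rewrite eij eqxx in ji.
Qed.

Lemma HamC_blockcol u : HamC k M t *m blockcol u =
  blockcol (fun i =>
    (if i.+1 == k then
       M k.-1 k.-1 t - M k.-1 k t *m invMkk *m (M k.-1 k t)^T
     else M i i t) *m u i
    + (if (i.+1 < k)%N then M i i.+1 t *m u i.+1 else 0)
    + (if i is i'.+1 then (M i' i t)^T *m u i' else 0)).
Proof.
rewrite /HamC /blockcol mul_mxblock_mxrow; apply: eq_mxcol => i.
set X := (X in X *m u i).
rewrite -(big_mkord xpredT (fun j => (if i == j :> nat then X
     else if j == i.+1 :> nat then M i j t
     else if i == j.+1 :> nat then (M j i t)^T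
     else 0) *m u j)).
have -> : X *m u i = \sum_(0 <= j < k | j == i :> nat) X *m u i.
  by rewrite big_nat1_eq ltn_ord.
have -> : (if (i.+1 < k)%N then M i i.+1 t *m u i.+1 else 0) =
    \sum_(0 <= j < k | j == i.+1) M i i.+1 t *m u i.+1.
  by rewrite big_nat1_eq.
have -> : (if nat_of_ord i is i'.+1 then (M i' i t)^T *m u i' else 0) =
    \sum_(0 <= j < k | i == j.+1 :> nat) (M j i t)^T *m u j.
  case: {X} i => -[|i] ik /=; first by rewrite big_pred0.
  by under eq_bigl do rewrite eqSS eq_sym; rewrite big_nat1_eq /= (ltnW ik).
rewrite (big_mkcond (fun j => i == j.+1 :> nat)).
rewrite (big_mkcond (fun j => j == i :> nat)).
rewrite (big_mkcond (fun j => j == i.+1)) -!big_split; apply: eq_bigr => j _ /=.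
rewrite [j == i :> nat]eq_sym.
case: (eqVneq (nat_of_ord i) j) => [<-|ij].
  by rewrite !(ltn_eqF (ltnSn _)) !addr0.
rewrite add0r; case: (eqVneq j i.+1) => [->|_].
  by rewrite ltn_eqF ?addr0 // ltnS ltnW.
by rewrite add0r; case: ifP; rewrite ?mul0mx.
Qed.

End hamiltonian_blocks.

(** * The Legendre transform of a Jacobi solution *)

Section jacobi_hamiltonian.
Variables (R : realType) (a b : R) (k n : nat) (M : nat -> nat -> R -> 'M[R]_n).
Hypothesis ab : a < b.
Let D : set R := `[a, b].
Hypotheses
  (smoothM : forall i, (i <= k)%N -> smooth_on D (M i i))
  (smoothM1 : forall i, (i < k)%N -> smooth_on D (M i i.+1))
  (symM : forall i t, (i <= k)%N -> D t -> sym_mx (M i i t))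
  (unitM : forall t, D t -> M k k t \in unitmx).
Variables (h : R -> 'cV[R]_n).
Hypothesis hjac : jacobi_solution k M a b h.

Let p j t := dLdq_along k M a b h j t.

Lemma dLdq_alongE j t : (j <= k)%N -> D t ->
  p j t = lagrangian_grad k M j t (jet a b h t).
Proof. by move=> jk Dt; rewrite /p /dLdq_along dLdqE //; exact: symM. Qed.

Let h_derivn N i : (N + i <= 2 * k)%N -> ntimes_derivable_on D N (derivn_on D i h).
Proof.
move=> Ni; apply: ntimes_derivable_on_derivn.
by apply: ntimes_derivable_on_le Ni _; case: hjac.
Qed.

(** dL/dq_j involves the derivatives of h of orders j - 1, j and, when j < k, j + 1.
    Differentiating j times reaches at most the order 2j + 1 <= 2k - 1 if j < k, and
    2k if j = k. *)
Lemma ntimes_derivable_dLdq_along j : (j <= k)%N ->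
  ntimes_derivable_on D j (p j).
Proof.
move=> jk.
apply: (@eq_ntimes_derivable_on _ _ _ ab _ _
    (fun t => lagrangian_grad k M j t (jet a b h t))).
  by move=> t Dt; rewrite dLdq_alongE.
apply: ntimes_derivable_onD => //; first apply: ntimes_derivable_onD => //.
- apply: ntimes_derivable_on_mulmx => //; first exact: smoothM.
  by apply: (@h_derivn j j); rewrite mul2n -addnn leq_add.
- case: ltnP => jk'; last exact: ntimes_derivable_on0.
  apply: ntimes_derivable_on_mulmx => //; first exact: smoothM1.
  by apply: (@h_derivn j j.+1); rewrite mul2n -addnn leq_add.
- case: j jk => [_|j jk]; first exact: ntimes_derivable_on0.
  apply: ntimes_derivable_on_mulmx => //.
    by apply: ntimes_derivable_on_trmx => //; exact: smoothM1.
  apply: (@h_derivn j.+1 j).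
  by rewrite mul2n -addnn leq_add // ltnW.
Qed.

(** For i >= 1 this is the momentum z_i; the same formula at i = 0 is the left-hand
    side of the Jacobi equation, which lets one recursion cover all the blocks. *)
Definition costate i t : 'cV[R]_n :=
  \sum_(i <= j < k.+1) (-1) ^+ (j - i) *: derivn_on D (j - i) (p j) t.

Lemma costate0 t : D t -> costate 0 t = 0.
Proof.
case: hjac => _ h0 Dt; rewrite -[RHS](h0 t Dt).
by apply: eq_bigr => j _; rewrite subn0.
Qed.

Lemma costatek t : costate k t = p k t.
Proof. by rewrite /costate big_nat1 subnn expr0 scale1r. Qed.

(** Differentiating the alternating sum raises every order of derivation by one,
    which is, up to sign, the sum for i without its first term. *)
Lemma costate_is_deriv i t : (i < k)%N -> D t ->
  is_deriv_on D (costate i.+1) t (p i t - costate i t).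
Proof.
move=> ik Dt.
have -> : p i t - costate i t = \sum_(i.+1 <= j < k.+1)
    (-1) ^+ (j - i.+1) *: derivn_on D (j - i.+1).+1 (p j) t.
  rewrite /costate big_ltn ?ltnS 1?ltnW // subnn expr0 scale1r opprD addNKr.
  rewrite -sumrN; apply: eq_big_nat => j /andP[ij _].
  by rewrite -(subnSK ij) exprS mulN1r scaleNr opprK.
rewrite /costate.
(* [is_deriv_on_sum] gives access to the summand only under the predicate of the
   sum, so the bounds on j are put there. *)
have -> : (fun t0 => \sum_(i.+1 <= j < k.+1)
     (-1) ^+ (j - i.+1) *: derivn_on D (j - i.+1) (p j) t0) =
   fun t0 => \sum_(i.+1 <= j < k.+1 | (i < j <= k)%N)
     (-1) ^+ (j - i.+1) *: derivn_on D (j - i.+1) (p j) t0.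
  by apply/funext => s; rewrite big_nat.
rewrite big_nat.
apply: is_deriv_on_sum => j /andP[ij jk]; apply: is_deriv_onZ.
apply: derivable_on_is_deriv; apply: ntimes_derivable_dLdq_along => //.
by rewrite ltn_subrL /= (leq_trans _ ij).
Qed.

Lemma legendre_yE t : legendre_y k a b h t = blockcol k (jet a b h t).
Proof. by []. Qed.

Lemma legendre_zE t :
  legendre_z k M a b h t = blockcol k (fun i => costate i.+1 t).
Proof. by []. Qed.

Lemma is_deriv_on_blockcol (u : R -> nat -> 'cV[R]_n) (l : nat -> 'cV[R]_n) t :
  (forall i, (i < k)%N -> is_deriv_on D (u^~ i) t (l i)) ->
  is_deriv_on D (fun s => blockcol k (u s)) t (blockcol k l).
Proof.
move=> ul; apply/is_deriv_on_mxP => i j.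
rewrite mxE; under eq_fun do rewrite mxE.
by have /is_deriv_on_mxP := ul (tagnat.sig1 i) (ltn_ord _); exact.
Qed.

(** The Legendre condition at work: z_k = M_kk h^(k) + M_(k-1)k^T h^(k-1) is solved
    for the highest derivative, which closes the system. *)
Lemma kth_deriv t : D t -> (0 < k)%N ->
  derivn_on D k h t = invmx (M k k t) *m costate k t
    - invmx (M k k t) *m (M k.-1 k t)^T *m derivn_on D k.-1 h t.
Proof.
move=> Dt k0; rewrite costatek dLdq_alongE // /lagrangian_grad ltnn addr0.
rewrite mulmxDr mulKmx ?unitM //; case: k k0 => //= k' _.
by rewrite mulmxA addrK.
Qed.

Lemma legendre_y_is_deriv t : D t ->
  is_deriv_on D (legendre_y k a b h) t
    (HamA k M t *m legendre_y k a b h t + HamB k M t *m legendre_z k M a b h t).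
Proof.
move=> Dt; rewrite legendre_yE legendre_zE.
rewrite HamA_blockcol HamB_blockcol blockcolD.
rewrite (@eq_blockcol _ _ _ _ (fun i => jet a b h t i.+1)) => [|i ik].
  apply: (@is_deriv_on_blockcol (jet a b h)) => i ik.
  apply: derivable_on_is_deriv.
  by case: hjac => hN _; apply: hN => //; rewrite (leq_trans ik) // leq_pmull.
case: eqP => [ik1|_]; last by rewrite addr0.
have k0 : (0 < k)%N by exact: leq_trans ik.
by rewrite /jet ik1 kth_deriv // -ik1 addrC.
Qed.

(** In the last block dL/dq_(k-1) contains h^(k); substituting [kth_deriv] produces
    the Schur complement in the corner of C and the feedback term of A^T. *)
Lemma legendre_z_is_deriv t : D t ->
  is_deriv_on D (legendre_z k M a b h) t
    (HamC k M t *m legendre_y k a b h t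
     - (HamA k M t)^T *m legendre_z k M a b h t).
Proof.
move=> Dt; rewrite legendre_yE legendre_zE.
rewrite HamC_blockcol trHamA_blockcol blockcolB.
rewrite (@eq_blockcol _ _ _ _ (fun i => p i t - costate i t)) => [|i ik].
  apply: (@is_deriv_on_blockcol (fun s i => costate i.+1 s)) => i ik.
  exact: costate_is_deriv.
have -> : (if i is i'.+1 then costate i'.+1 t else 0) = costate i t.
  by case: i {ik} => //; rewrite costate0.
have ikW := ltnW ik.
rewrite dLdq_alongE // /lagrangian_grad ik opprB addrA; congr (_ - _).
rewrite addrAC; congr (_ + _).
case: (eqVneq i.+1 k) => ik1; last by rewrite addr0 ltn_neqAle ik1 ik.
have k0 : (0 < k)%N by exact: leq_trans ik.
have ki : k.-1 = i by rewrite -ik1.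
rewrite !ik1 ltnn addr0 /jet kth_deriv // ki trmx_inv symM // mulmxBl mulmxBr.
by rewrite !mulmxA [RHS]addrA [RHS]addrAC.
Qed.

End jacobi_hamiltonian.

(** * Invertibility and symmetry of the coefficients *)

(** A kernel vector would be isotropic. *)
Lemma posdef_mx_unit (R : realType) (n : nat) (S : 'M[R]_n) :
  posdef_mx S -> S \in unitmx.
Proof.
move=> Spos; rewrite unitmxE unitfE; apply/negP => /det0P[v v0 vS].
have := Spos v^T; rewrite trmxK vS mul0mx mxE ltxx => /(_ _)/negP[] //.
by rewrite -trmx0 (inj_eq trmx_inj).
Qed.

Lemma HamB_sym (R : realType) (n k : nat) (M : nat -> nat -> R -> 'M[R]_n) t :
  sym_mx (M k k t) -> sym_mx (HamB k M t).
Proof.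
move=> Ms; rewrite /sym_mx /HamB tr_mxblock; apply: eq_mxblock => i j.
by rewrite andbC; case: ifP; rewrite ?trmx0 // trmx_inv Ms.
Qed.

Lemma HamC_sym (R : realType) (n k : nat) (M : nat -> nat -> R -> 'M[R]_n) t :
  (forall i, (i <= k)%N -> sym_mx (M i i t)) -> sym_mx (HamC k M t).
Proof.
move=> Ms; rewrite /sym_mx /HamC tr_mxblock; apply: eq_mxblock => i j.
rewrite [j == i :> nat]eq_sym.
case: (eqVneq (nat_of_ord i) j) => [ij|ij].
  rewrite ij; case: ifP => _; last by rewrite Ms // ltnW.
  by rewrite linearB /= !trmx_mul trmxK trmx_inv !Ms ?leq_pred // mulmxA.
case: (eqVneq (nat_of_ord i) j.+1) => [ji|ji].
  by rewrite ji ltn_eqF.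
by case: ifP; rewrite ?trmxK ?trmx0.
Qed.

(** * Matrix solutions of a linear Hamiltonian system *)

Section matrix_hamiltonian_system.
Variables (R : realType) (N : nat).
Implicit Types (A B C Y Z : 'M[R]_N).

(** The Wronskian of a Hamiltonian system is conserved: in its derivative the
    terms in A cancel in pairs, those in B and C by symmetry. *)
Lemma hamiltonian_symplectic (a b : R) (A B C Y Z : R -> 'M[R]_N) :
  (forall t, `[a, b]%classic t -> sym_mx (B t)) ->
  (forall t, `[a, b]%classic t -> sym_mx (C t)) ->
  (forall t, `[a, b]%classic t ->
    is_deriv_on `[a, b] Y t (A t *m Y t + B t *m Z t)) ->
  (forall t, `[a, b]%classic t ->
    is_deriv_on `[a, b] Z t (C t *m Y t - (A t)^T *m Z t)) ->
  forall t, `[a, b]%classic t ->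
    (Y t)^T *m Z t - (Z t)^T *m Y t = (Y a)^T *m Z a - (Z a)^T *m Y a.
Proof.
move=> Bs Cs dY dZ t tab; apply/matrixP => i j.
pose f s := ((Y s)^T *m Z s - (Z s)^T *m Y s) i j.
suff f0 s : `[a, b]%classic s -> is_deriv_on `[a, b] f s 0.
  exact: (is_deriv_on0_cst f0).
move=> sab; have dYT := is_deriv_on_trmx (dY s sab).
have dZT := is_deriv_on_trmx (dZ s sab).
have /is_deriv_on_mxP/(_ i j) := is_deriv_onB
  (is_deriv_on_mulmx dYT (dZ s sab)) (is_deriv_on_mulmx dZT (dY s sab)).
set E := _ - _; suff -> : E = 0 by rewrite mxE.
rewrite /E ![(_ + _)^T]linearD /= ![(- _)^T]linearN /= !trmx_mul trmxK Bs // Cs //.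
rewrite !(mulmxDl, mulmxDr, mulmxN, mulNmx, mulmxA).
(* Only additive cancellation is left; [ring] reaches it entry by entry, with the
   matrix products as atoms. *)
have zmod_id (p q r v : 'M[R]_N) : p + q + (r - p) - (r - v + (v + q)) = 0.
  by apply/matrixP => c d; rewrite !mxE; ring.
exact: zmod_id.
Qed.

(** The product rule yields the derivative of y^T W y without W' being formed:
    the contributions of Y', Z' and y' add up to the Riccati combination, in which
    W^T = W and B^T = B complete the square. *)
Lemma picone_riccati (D : set R) (t : R) (A B C : 'M[R]_N)
    (Y Z : R -> 'M[R]_N) (y z : R -> 'cV[R]_N) :
  D t -> (forall s, D s -> Y s \in unitmx) -> sym_mx B ->
  (Y t)^T *m Z t = (Z t)^T *m Y t ->
  is_deriv_on D Y t (A *m Y t + B *m Z t) ->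
  is_deriv_on D Z t (C *m Y t - A^T *m Z t) ->
  is_deriv_on D y t (A *m y t + B *m z t) ->
  let w := z t - Z t *m invmx (Y t) *m y t in
  is_deriv_on D (fun s => (y s)^T *m Z s *m invmx (Y s) *m y s) t
    ((z t)^T *m B *m z t + (y t)^T *m C *m y t - w^T *m B *m w).
Proof.
move=> Dt Yu Bs YZ dY dZ dy w.
have Yt := Yu t Dt.
have := is_deriv_on_mulmx (is_deriv_on_mulmx (is_deriv_on_mulmx
  (is_deriv_on_trmx dy) dZ) (is_deriv_on_invmx Dt Yu dY)) dy.
congr (is_deriv_on _ _ _ _).
set X := invmx (Y t); pose W := Z t *m X.
(* Once Z t is written as W Y t, every Y t in the derivative meets the inverse X
   next to it. *)
have ZE : Z t = W *m Y t by rewrite -mulmxA mulVmx ?mulmx1.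
have Ws : W^T = W.
  rewrite /W /X trmx_mul trmx_inv.
  apply: (canLR (mulKmx _)); first by rewrite unitmx_tr.
  by rewrite mulmxA YZ mulmxK.
rewrite {}/w -/X -/W; clearbody W; rewrite ZE.
rewrite ![(_ + _)^T]linearD /= ![(- _)^T]linearN /= !trmx_mul Bs Ws.
rewrite !(mulmxDl, mulmxDr, mulmxN, mulNmx, mulmxA).
rewrite !(mulmxK Yt).
(* Only additive cancellation is left; [ring] reaches it entry by entry, with the
   matrix products as atoms. *)
have zmod_id (p q r v s u e : 'M[R]_1) : p + q + (r - p) - (v + s) + (v + u) =
    e + r - (e - u + (- q - - s)).
  by apply/matrixP => i j; rewrite !mxE; ring.
exact: zmod_id.
Qed.

End matrix_hamiltonian_system.

(** * The generalized Picone identity *)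

Lemma is_deriv_on_cols_mx (R : realType) (D : set R) (m p N : nat) (t : R)
    (f : 'I_N -> R -> 'cV[R]_m) (X : 'M[R]_(m, p)) (g : 'I_N -> R -> 'cV[R]_p)
    (X' : 'M[R]_m) :
  (forall j, is_deriv_on D (f j) t (X' *m f j t + X *m g j t)) ->
  is_deriv_on D (fun s => cols_mx (fun j => f j s)) t
    (X' *m cols_mx (fun j => f j t) + X *m cols_mx (fun j => g j t)).
Proof.
move=> fl; apply/is_deriv_on_mxP => i j.
under eq_fun do rewrite mxE.
have /is_deriv_on_mxP/(_ i 0) := fl j.
rewrite !mxE; congr (is_deriv_on _ _ _ (_ + _));
  by apply: eq_bigr => r _; rewrite !mxE.
Qed.

Theorem theorem4p6 (R : realType) (a b : R) (k n : nat)
    (M : nat -> nat -> R -> 'M[R]_n)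
    (h : 'I_(kn k n) -> R -> 'cV[R]_n)
    (y z : R -> 'cV[R]_(kn k n)) :
  a < b -> (1 <= k)%N -> (1 <= n)%N ->
  (forall i, (i <= k)%N -> smooth_on `[a, b] (M i i)) ->
  (forall i, (i < k)%N -> smooth_on `[a, b] (M i i.+1)) ->
  (forall i t, (i <= k)%N -> t \in `[a, b] -> sym_mx (M i i t)) ->
  (forall t, t \in `[a, b] -> posdef_mx (M k k t)) ->
  (forall i, jacobi_solution k M a b (h i)) ->
  lin_indep_on `[a, b] h ->
  (forall i j, (j < k)%N -> derivn_on `[a, b] j (h i) a = 0) ->
  let Y t := cols_mx (fun i => legendre_y k a b (h i) t) in
  let Z t := cols_mx (fun i => legendre_z k M a b (h i) t) in
  (forall t, t \in `]a, b] -> Y t \in unitmx) ->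
  (forall t, t \in `]a, b] ->
     is_deriv_on `]a, b] y t (HamA k M t *m y t + HamB k M t *m z t)) ->
  (forall t, t \in `[a, b] -> (Y t)^T *m Z t - (Z t)^T *m Y t = 0) /\
  forall t, t \in `]a, b] ->
    let w := z t - Z t *m invmx (Y t) *m y t in
    is_deriv_on `]a, b]
      (fun s => ((y s)^T *m Z s *m invmx (Y s) *m y s) 0 0 : R) t
      (((z t)^T *m HamB k M t *m z t) 0 0
       + ((y t)^T *m HamC k M t *m y t) 0 0
       - (w^T *m HamB k M t *m w) 0 0).
Proof.
move=> ab k0 _ sM sM1 symM posM hjac _ ha Y Z Yu dy.
have unitM t : t \in `[a, b] -> M k k t \in unitmx.
  by move=> tab; exact/posdef_mx_unit/posM.
have Bs t : t \in `[a, b] -> sym_mx (HamB k M t).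
  by move=> tab; apply: HamB_sym; exact: symM.
have dY t : t \in `[a, b] ->
    is_deriv_on `[a, b] Y t (HamA k M t *m Y t + HamB k M t *m Z t).
  move=> tab; apply: (@is_deriv_on_cols_mx _ _ _ _ _ _
    (fun j => legendre_y k a b (h j)) _ (fun j => legendre_z k M a b (h j))) => j.
  exact: legendre_y_is_deriv.
have dZ t : t \in `[a, b] ->
    is_deriv_on `[a, b] Z t (HamC k M t *m Y t - (HamA k M t)^T *m Z t).
  move=> tab; rewrite addrC -mulNmx; apply: (@is_deriv_on_cols_mx _ _ _ _ _ _
    (fun j => legendre_z k M a b (h j)) _ (fun j => legendre_y k a b (h j))) => j.
  by rewrite mulNmx addrC; exact: legendre_z_is_deriv.
have Ya : Y a = 0.
  by apply/matrixP => i j; rewrite !mxE ha ?mxE //; exact: ltn_ord.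
have YZ t : t \in `[a, b] -> (Y t)^T *m Z t - (Z t)^T *m Y t = 0.
  move=> tab.
  rewrite (@hamiltonian_symplectic _ _ a b (HamA k M) (HamB k M) (HamC k M)) //.
    by rewrite Ya trmx0 mul0mx mulmx0 subr0.
  by move=> s sab; apply: HamC_sym => i ik; exact: symM.
split=> // t tab w.
have sub : `]a, b] `<=` `[a, b] by exact: subset_itv_oc_cc.
have tab' := sub t tab.
have /is_deriv_on_mxP/(_ 0 0) := picone_riccati tab Yu (Bs t tab')
  (subr0_eq (YZ t tab')) (is_deriv_on_subset sub (dY t tab'))
  (is_deriv_on_subset sub (dZ t tab')) (dy t tab).
rewrite -/w; congr is_deriv_on.
by rewrite [LHS]mxE [X in X + _]mxE [X in _ + X]mxE.
Qed.
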